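(* For the DR-RC-Iterative-MPC procedure (defined in the context), if $\mathcal{D}^{j}\subset\mathcal{D}^{j-1}$ for some iteration $j\ge1$, then $$\mathcal{S}^j=\mathcal{S}^{j-1}\cup\{(j,x_t^j,J^j_{(t:\infty)})\}_{t=1}^{T_j}.$$ As a consequence, $\mathcal{S}^{j-1}\subseteq\mathcal{S}^j$. In addition, if the optimal value function $\mathcal{J}_{(\mathcal{S}^{j},\mathcal{D}^{j})}$ is continuous at $x_F$, then $J^{j+1}_{(0:\infty)}\le J^{j}_{(0:\infty)}$.
   Context: Notation: $\mathbb{N}=\{0,1,2,\dots\}$, $[z]_+=\max(z,0)$. For a random variable $Z$ with distribution $\mu$ and $\beta\in(0,1)$, $\mathrm{CVaR}_\beta^{\mu}[Z]=\inf_{s\in\mathbb{R}}\{s+\beta^{-1}\mathbb{E}^{\mu}[Z-s]_+\}$. $\subset$ denotes (not necessarily strict) inclusion. Problem data. The system is $x_{t+1}=f(x_t,u_t)$ with $f:\mathbb{R}^{n_x}\times\mathbb{R}^{n_u}\to\mathbb{R}^{n_x}$; states and inputs are constrained to compact sets $\mathcal{X}\subset\mathbb{R}^{n_x}$, $\mathcal{U}\subset\mathbb{R}^{n_u}$. $x_S\in\mathcal{X}$ is the initial state and $x_F\in\mathcal{X}$ the target equilibrium, i.e. $0\in\mathcal{U}$ and $f(x_F,0)=x_F$. The stage cost $r:\mathcal{X}\times\mathcal{U}\to[0,\infty)$ is continuous, $r(x_F,0)=0$ and $r(x,u)>0$ for $(x,u)\ne(x_F,0)$. $w$ is a random variable supported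 on a compact set $\mathcal{W}\subset\mathbb{R}^{n_w}$; $g:\mathcal{X}\times\mathcal{W}\to\mathbb{R}$ is continuous; $\delta>0$, $\beta\in(0,1)$ and the horizon $K\in\mathbb{N}$, $K\ge1$, are given. Ambiguity sets. $\mathbb{D}$ is a map assigning to each finite dataset of samples from $\mathcal{W}$ a closed nonempty set of probability distributions supported on $\mathcal{W}$. With $\widehat{\mathcal{W}}^{j}$ the dataset of i.i.d. samples of $w$ available at the end of iteration $j$ (with $\widehat{\mathcal{W}}^{0}$ given initially, and one sample per time-step added during each iteration), set $\mathcal{D}^{j}=\mathbb{D}(\widehat{\mathcal{W}}^{j})$. Sampled-safe-sets. A sampled-safe-set is a finite set $\mathcal{S}\subset\mathbb{N}\times\mathcal{X}\times[0,\infty)$ of triples (trajectory index $i$, state $x$, cost-to-go $J$). $\Pi_{\mathrm{state}}(\mathcal{S})$ is the set of states appearing in it. Its minimum cost-to-go is $Q_{\mathcal{S}}(x)=\min\{J:(i,x,J)\in\mathcal{S}\}$ for $x\in\Pi_{\mathrm{state}}(\mathcal{S})$, and $+\infty$ otherwise. Finite-horizon problem. For a state $x$, sampled-safe-set $\overline{\mathcal{S}}$ and ambiguity set $\overline{\mathcal{D}}$, $\mathrm{FH}(x;\overline{\mathcal{S}},\overline{\mathcal{D}})$ is: minimize $\sum_{k=0}^{K-1}r(x_k,u_k)+Q_{\overline{\mathcal{S}}}(x_K)$ over $(x_0,\dots,x_K)$, $(u_0,\dots,u_{K-1})$ subject to $x_0=x$; $x_{k+1}=f(x_k,u_k)$,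 $x_k\in\mathcal{X}$, $u_k\in\mathcal{U}$, $\sup_{\mu\in\overline{\mathcal{D}}}\mathrm{CVaR}_\beta^{\mu}[g(x_k,w)]\le\delta$ for all $k=0,\dots,K-1$; and $x_K\in\Pi_{\mathrm{state}}(\overline{\mathcal{S}})$. Its optimal value is $\mathcal{J}_{(\overline{\mathcal{S}},\overline{\mathcal{D}})}(x)\in[0,\infty)$, defined on the set of states $x\in\mathcal{X}$ for which the problem is feasible; continuity at $x_F$ is meant relative to this set. Whenever the problem is feasible, the minimum is taken to be attained. Routine $\mathrm{DR\_MPC}(\overline{\mathcal{S}},\overline{\mathcal{D}})$: start with $t=0$, $x_0=x_S$. While $x_t\ne x_F$: solve $\mathrm{FH}(x_t;\overline{\mathcal{S}},\overline{\mathcal{D}})$, let $u_t$ be the first input of an optimizer, set $x_{t+1}=f(x_t,u_t)$, and increase $t$ by one. Return the state and input sequences. After $x_F$ is reached, the state stays at $x_F$ with zero input. DR-RC-Iterative-MPC: for $j=1,2,\dots$: (1) $(\mathsf{x}^j,\mathsf{u}^j)=\mathrm{DR\_MPC}(\mathcal{S}^{j-1},\mathcal{D}^{j-1})$, with $\mathsf{x}^j=[x_0^j,\dots,x_{T_j}^j]$, $\mathsf{u}^j=[u_0^j,\dots,u_{T_j-1}^j]$ and length $T_j$; (2) $\widehat{\mathcal{W}}^{j}$ is $\widehat{\mathcal{W}}^{j-1}$ with the $T_j$ new samples added, $\mathcal{D}^j=\mathbb{D}(\widehat{\mathcal{W}}^j)$; (3) form $\tilde{\mathcal{S}}=\mathcal{S}^{j-1}\cup\{(j,x_t^j,J^j_{(t:\infty)})\}_{t=1}^{T_j}$,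 where $J^j_{(t:\infty)}=\sum_{k=t}^{\infty}r(x_k^j,u_k^j)$; (4) $\mathcal{S}^j$ is obtained from $\tilde{\mathcal{S}}$ by deleting all triples of every trajectory index $i$ for which some $(i,x,J)\in\tilde{\mathcal{S}}$ has $\sup_{\mu\in\mathcal{D}^j}\mathrm{CVaR}_\beta^{\mu}[g(x,w)]>\delta$. Standing assumption: the trajectories are of finite length $T_j\ge1$, ending at $x_F$. The cost of iteration $j$ is $J^j_{(0:\infty)}$. Initialization assumption (standing): $\mathcal{S}^0$ consists of the triples (index $0$, state, cost-to-go) for the states of a finite-length trajectory of the system, generated by inputs in $\mathcal{U}$, that starts at $x_S$ and reaches $x_F$, and is robustly safe: $x\in\mathcal{X}$ and $g(x,w)\le\delta$ for all $w\in\mathcal{W}$ and all $x\in\Pi_{\mathrm{state}}(\mathcal{S}^0)$. *)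

(* Defs.v *)
From HB Require Import structures.
From mathcomp Require Import all_boot all_order all_algebra finmap.
From mathcomp Require Import all_classical all_reals all_analysis.

Set Implicit Arguments.
Unset Strict Implicit.
Unset Printing Implicit Defensive.

Import Order.TTheory GRing.Theory Num.Theory.
Import numFieldNormedType.Exports.

Local Open Scope classical_set_scope.
Local Open Scope ring_scope.

(* R^n with its Borel sigma-algebra. *)
Notation borelRV R n := (g_sigma_algebraType (@open 'rV[R]_n)).

(* Closedness, for the weak topology, of a set of probability distributions
   among those supported on W: the weak topology on distributions supported on
   a compact W is generated by the maps mu |-> \int[mu]_W h with h continuous
   on W, and M is closed iff it contains its adherent points. *)
Definition weakly_closed (R : realType) (n : nat) (W : set 'rV[R]_n)
    (M : set (probability (borelRV R n) R)) : Prop :=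
  forall mu : probability (borelRV R n) R, mu W = 1%E ->
    (forall (m : nat) (h : 'I_m -> 'rV[R]_n -> R) (eps : R),
       (forall i, {within W, continuous (h i)}) -> 0 < eps ->
       exists2 nu, M nu &
         forall i, `| \int[mu]_(w in W) h i w - \int[nu]_(w in W) h i w | < eps) ->
    M mu.

(* The expectation is taken over W, outside of which Z is irrelevant. *)
Definition CVaR (R : realType) (n : nat) (W : set 'rV[R]_n) (beta : R)
    (mu : probability (borelRV R n) R) (Z : 'rV[R]_n -> R) : \bar R :=
  ereal_inf [set (s%:E +
      (beta^-1)%:E * \int[mu]_(w in W) (Num.max (Z w - s) 0)%:E)%E | s in [set: R]].

(* [stage_cost] and [constr] are total functions of which only the values on
   [Xset] x [Uset] and [Xset] x [Wset] matter. A dataset is a finite list of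
   samples. *)
Record problem (R : realType) (nx nu nw : nat) := Problem {
  dyn : 'rV[R]_nx -> 'rV[R]_nu -> 'rV[R]_nx;
  Xset : set 'rV[R]_nx;
  Uset : set 'rV[R]_nu;
  Wset : set 'rV[R]_nw;
  x_start : 'rV[R]_nx;
  x_final : 'rV[R]_nx;
  stage_cost : 'rV[R]_nx -> 'rV[R]_nu -> R;
  constr : 'rV[R]_nx -> 'rV[R]_nw -> R;
  delta : R;
  beta : R;
  horizon : nat;
  ambiguity : seq 'rV[R]_nw -> set (probability (borelRV R nw) R);

  Xset_compact : compact Xset;
  Uset_compact : compact Uset;
  Wset_compact : compact Wset;
  x_start_Xset : Xset x_start;
  x_final_Xset : Xset x_final;
  zero_Uset : Uset 0;
  x_final_equilibrium : dyn x_final 0 = x_final;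
  stage_cost_continuous :
    {within Xset `*` Uset, continuous (fun z => stage_cost z.1 z.2)};
  stage_cost_ge0 : forall x u, Xset x -> Uset u -> 0 <= stage_cost x u;
  stage_cost_final : stage_cost x_final 0 = 0;
  stage_cost_gt0 : forall x u, Xset x -> Uset u ->
    (x, u) <> (x_final, 0) -> 0 < stage_cost x u;
  constr_continuous :
    {within Xset `*` Wset, continuous (fun z => constr z.1 z.2)};
  delta_gt0 : 0 < delta;
  beta_gt0 : 0 < beta;
  beta_lt1 : beta < 1;
  horizon_ge1 : (1 <= horizon)%N;
  ambiguity_supported : forall s, (forall w, w \in s -> Wset w) ->
    forall mu, ambiguity s mu -> mu Wset = 1%E;
  ambiguity_closed : forall s, (forall w, w \in s -> Wset w) ->
    weakly_closed Wset (ambiguity s);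
  ambiguity_nonempty : forall s, (forall w, w \in s -> Wset w) ->
    ambiguity s !=set0
}.

(* Triples (trajectory index, state, cost-to-go). *)
Definition safe_set (R : realType) (nx : nat) :=
  {fset (nat * 'rV[R]_nx * R)}.

Definition Pi_state (R : realType) (nx : nat) (S : safe_set R nx) :
    {fset 'rV[R]_nx} :=
  [fset p.1.2 | p in S]%fset.

(* The empty minimum is +oo. *)
Definition min_cost_to_go (R : realType) (nx : nat) (S : safe_set R nx)
    (x : 'rV[R]_nx) : \bar R :=
  \big[Order.min/+oo%E]_(p <- S | p.1.2 == x) (p.2)%:E.

Definition risk (R : realType) (nx nu nw : nat) (pb : problem R nx nu nw)
    (D : set (probability (borelRV R nw) R)) (x : 'rV[R]_nx) : \bar R :=
  ereal_sup [set CVaR (Wset pb) (beta pb) mu (constr pb x) | mu in D].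

(* State and input sequences are functions on nat; in FH only
   x_0, ..., x_K and u_0, ..., u_{K-1} matter. *)
Definition FH_feasible (R : realType) (nx nu nw : nat)
    (pb : problem R nx nu nw) (S : safe_set R nx)
    (D : set (probability (borelRV R nw) R)) (x : 'rV[R]_nx)
    (xs : nat -> 'rV[R]_nx) (us : nat -> 'rV[R]_nu) : Prop :=
  [/\ xs 0%N = x,
      forall k, (k < horizon pb)%N ->
        [/\ xs k.+1 = dyn pb (xs k) (us k), Xset pb (xs k), Uset pb (us k)
          & (risk pb D (xs k) <= (delta pb)%:E)%E]
    & xs (horizon pb) \in Pi_state S].

Definition FH_cost (R : realType) (nx nu nw : nat) (pb : problem R nx nu nw)
    (S : safe_set R nx) (xs : nat -> 'rV[R]_nx) (us : nat -> 'rV[R]_nu) :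
    \bar R :=
  ((\sum_(0 <= k < horizon pb) stage_cost pb (xs k) (us k))%R%:E
    + min_cost_to_go S (xs (horizon pb)))%E.

Definition FH_optimizer (R : realType) (nx nu nw : nat)
    (pb : problem R nx nu nw) (S : safe_set R nx)
    (D : set (probability (borelRV R nw) R)) (x : 'rV[R]_nx)
    (xs : nat -> 'rV[R]_nx) (us : nat -> 'rV[R]_nu) : Prop :=
  FH_feasible pb S D x xs us /\
  forall ys vs, FH_feasible pb S D x ys vs ->
    (FH_cost pb S xs us <= FH_cost pb S ys vs)%E.

Definition FH_domain (R : realType) (nx nu nw : nat)
    (pb : problem R nx nu nw) (S : safe_set R nx)
    (D : set (probability (borelRV R nw) R)) : set 'rV[R]_nx :=
  [set x | Xset pb x /\ exists xs us, FH_feasible pb S D x xs us].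

Definition FH_value (R : realType) (nx nu nw : nat) (pb : problem R nx nu nw)
    (S : safe_set R nx) (D : set (probability (borelRV R nw) R))
    (x : 'rV[R]_nx) : \bar R :=
  ereal_inf [set c | exists xs us,
    FH_feasible pb S D x xs us /\ c = FH_cost pb S xs us].

Definition FH_value_continuous_at_final (R : realType) (nx nu nw : nat)
    (pb : problem R nx nu nw) (S : safe_set R nx)
    (D : set (probability (borelRV R nw) R)) : Prop :=
  FH_value pb S D x @[x --> within (FH_domain pb S D) (nbhs (x_final pb))]
    --> FH_value pb S D (x_final pb).

(* A trajectory of length T that ends at x_F is continued by staying at x_F
   with zero input. *)
Definition stays_at_final (R : realType) (nx nu nw : nat)
    (pb : problem R nx nu nw) (T : nat)
    (xs : nat -> 'rV[R]_nx) (us : nat -> 'rV[R]_nu) : Prop :=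
  forall t, (T <= t)%N -> xs t = x_final pb /\ us t = 0.

(* The sum of the stage costs over k >= t. *)
Definition cost_to_go (R : realType) (nx nu nw : nat)
    (pb : problem R nx nu nw) (xs : nat -> 'rV[R]_nx) (us : nat -> 'rV[R]_nu)
    (t : nat) : R :=
  limn (fun n => \sum_(t <= k < n) stage_cost pb (xs k) (us k)).

Definition triples (R : realType) (nx nu nw : nat) (pb : problem R nx nu nw)
    (i : nat) (xs : nat -> 'rV[R]_nx) (us : nat -> 'rV[R]_nu) (ts : seq nat) :
    safe_set R nx :=
  [fset (i, xs t, cost_to_go pb xs us t) | t in ts]%fset.

(* (xs, us) is a possible outcome, of length T, of DR_MPC(S, D); it is a
   relation because the optimizers need not be unique. *)
Definition DR_MPC (R : realType) (nx nu nw : nat) (pb : problem R nx nu nw)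
    (S : safe_set R nx) (D : set (probability (borelRV R nw) R)) (T : nat)
    (xs : nat -> 'rV[R]_nx) (us : nat -> 'rV[R]_nu) : Prop :=
  [/\ xs 0%N = x_start pb,
      forall t, (t < T)%N -> xs t <> x_final pb /\
        exists ys vs, [/\ FH_optimizer pb S D (xs t) ys vs, us t = vs 0%N
          & xs t.+1 = dyn pb (xs t) (us t)]
    & stays_at_final pb T xs us].

(* Deletes from S every trajectory having a state that is unsafe w.r.t. D. *)
Definition prune (R : realType) (nx nu nw : nat) (pb : problem R nx nu nw)
    (D : set (probability (borelRV R nw) R)) (S : safe_set R nx) :
    safe_set R nx :=
  [fset p in S | ~~ `[< exists q, [/\ q \in S, q.1.1 = p.1.1
                          & ((delta pb)%:E < risk pb D q.1.2)%E] >]]%fset.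

Definition initial_safe_set (R : realType) (nx nu nw : nat)
    (pb : problem R nx nu nw) (S : safe_set R nx) : Prop :=
  (exists (T : nat) (xs : nat -> 'rV[R]_nx) (us : nat -> 'rV[R]_nu),
    [/\ xs 0%N = x_start pb,
        forall t, (t < T)%N ->
          Uset pb (us t) /\ xs t.+1 = dyn pb (xs t) (us t),
        stays_at_final pb T xs us
      & S = triples pb 0 xs us (iota 0 T.+1)]) /\
  (forall x, x \in Pi_state S ->
    Xset pb x /\ forall w, Wset pb w -> constr pb x w <= delta pb).

(* The samples w 0, w 1, ... are consumed in order: N0 of them are given
   initially and iteration i draws T i more, so that this is the dataset at the
   end of iteration j. *)
Definition dataset (R : realType) (nw : nat) (w : nat -> 'rV[R]_nw) (N0 : nat)
    (T : nat -> nat) (j : nat) : seq 'rV[R]_nw :=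
  [seq w n | n <- iota 0 (N0 + \sum_(1 <= i < j.+1) T i)].

Definition ambiguity_at (R : realType) (nx nu nw : nat)
    (pb : problem R nx nu nw) (w : nat -> 'rV[R]_nw) (N0 : nat)
    (T : nat -> nat) (j : nat) : set (probability (borelRV R nw) R) :=
  ambiguity pb (dataset w N0 T j).

(* A realization of the iterative procedure along the sequence of samples w:
   iteration j has length T j, trajectory (xs j, us j) and final
   sampled-safe-set S j. *)
Record iterative_MPC (R : realType) (nx nu nw : nat)
    (pb : problem R nx nu nw) (w : nat -> 'rV[R]_nw) (N0 : nat)
    (S : nat -> safe_set R nx) (T : nat -> nat)
    (xs : nat -> nat -> 'rV[R]_nx) (us : nat -> nat -> 'rV[R]_nu) : Prop := {
  run_initial : initial_safe_set pb (S 0%N);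
  run_DR_MPC : forall j, (1 <= j)%N ->
    DR_MPC pb (S j.-1) (ambiguity_at pb w N0 T j.-1) (T j) (xs j) (us j);
  run_safe_set : forall j, (1 <= j)%N ->
    S j = prune pb (ambiguity_at pb w N0 T j)
      (S j.-1 `|` triples pb j (xs j) (us j) (iota 1 (T j)))%fset;
  run_length : forall j, (1 <= j)%N -> (1 <= T j)%N;
  run_attained : forall j x,
    FH_domain pb (S j) (ambiguity_at pb w N0 T j) x ->
    exists ys vs, FH_optimizer pb (S j) (ambiguity_at pb w N0 T j) x ys vs
}.

(* The random vectors w 0, w 1, ... are independent with distribution law. *)
Definition iid_samples (d : measure_display) (Omega : measurableType d)
    (R : realType) (n : nat) (P : probability Omega R)
    (law : probability (borelRV R n) R)
    (w : nat -> Omega -> borelRV R n) : Prop :=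
  [/\ forall k, measurable_fun setT (w k),
      forall k A, measurable A -> P (w k @^-1` A) = law A
    & forall (s : seq nat) (A : nat -> set (borelRV R n)), uniq s ->
        (forall k, measurable (A k)) ->
        P (\bigcap_(k in [set` s]) (w k @^-1` A k)) =
          (\prod_(k <- s) P (w k @^-1` A k))%E].

(* Main.v *)
Require Import Defs.
From mathcomp Require Import all_boot all_order all_algebra finmap.
From mathcomp Require Import all_classical all_reals all_analysis.

Import numFieldNormedType.Exports.

Local Open Scope classical_set_scope.
Local Open Scope ring_scope.

Set Implicit Arguments.
Unset Strict Implicit.
Unset Printing Implicit Defensive.

Import Order.TTheory GRing.Theory Num.Theory.

(** The risk of a state is a supremum over the ambiguity set, so it can only
    decrease when that set shrinks. Hence every state that was certified safe
    for the ambiguity set of iteration j-1 remains so for that of iteration j: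
    the stored states by the pruning that ended iteration j-1 (or by robust
    safety, for the initial trajectory), and the states visited in iteration j
    because each of them is the first state of a feasible finite-horizon
    problem. The target is the exception, as no problem is solved there; it is
    robustly safe because the initial trajectory ends at it. So nothing is
    deleted ([run_no_deletion]).

    The cost bound compares both iterations with the finite-horizon problem
    that iteration j+1 solves at the initial state. The first K steps of
    trajectory j are feasible for it, since the state reached after them is
    stored, and the value of that solution is at most the cost of iteration j,
    as the terminal cost is a minimum over the stored costs-to-go
    ([FH_feasible_stored]). Conversely, every feasible solution at a state of
    trajectory j+1 costs at least what that trajectory spends from there on
    ([DR_MPC_cost_le]). This is a backward induction along the trajectory: an
    optimizer, deprived of its first step and extended by one step along the
    stored trajectory on which it ends, is feasible at the next state, and the
    optimal cost has decreased by at least the stage cost just paid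
    ([FH_shift]).

    The extension step needs that each stored triple has a stored successor.
    This invariant, [continuable], holds for whole trajectories and survives
    pruning because pruning deletes trajectories as a whole. *)

Section IterativeMPC.
Context (R : realType) (nx nu nw : nat) (pb : problem R nx nu nw).

Local Notation state := 'rV[R]_nx.
Local Notation input := 'rV[R]_nu.
Local Notation ambiguity_set := (set (probability (borelRV R nw) R)).
Implicit Types (S : safe_set R nx) (D : ambiguity_set) (x : state).
Implicit Types (xs : nat -> state) (us : nat -> input).

(** * Risk *)

Lemma risk_subset D1 D2 x : D1 `<=` D2 -> (risk pb D1 x <= risk pb D2 x)%E.
Proof. by move=> D12; apply: ereal_sup_le; apply: image_subset. Qed.

(** The value [delta] of the infimum variable of CVaR makes the positive part
    vanish on the support. *)
Lemma risk_robustly_safe D x :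
  (forall w, Wset pb w -> constr pb x w <= delta pb) ->
  (risk pb D x <= (delta pb)%:E)%E.
Proof.
move=> safe; apply: ge_ereal_sup => _ [mu _ <-].
apply: ereal_inf_lbound; exists (delta pb) => //.
rewrite (eq_integral (cst 0%E)) ?integral0 ?mule0 ?adde0// => w.
by rewrite inE => /safe ?; rewrite (max_idPr _) // subr_le0.
Qed.

(** * Cost-to-go *)

(** The stage cost vanishes at the equilibrium, so the partial sums are constant
    from [T] on. *)
Lemma cost_to_goE T xs us t : stays_at_final pb T xs us ->
  cost_to_go pb xs us t = \sum_(t <= k < T) stage_cost pb (xs k) (us k).
Proof.
move=> fin; apply: lim_near_cst => //; near=> n.
have Tn : (T <= n)%N by near: n; exact: nbhs_infty_ge.
have tail m : (T <= m)%N -> \sum_(m <= k < n) stage_cost pb (xs k) (us k) = 0.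
  move=> Tm; rewrite big_nat; apply: big1 => k /andP[mk _].
  by have [-> ->] := fin k (leq_trans Tm mk); rewrite stage_cost_final.
have [tT|/ltnW Tt] := leqP t T; first by rewrite (big_cat_nat tT Tn) /= tail ?addr0.
by rewrite tail // big_geq.
Unshelve. all: by end_near. Qed.

Lemma cost_to_go_rec T xs us t : stays_at_final pb T xs us ->
  cost_to_go pb xs us t = stage_cost pb (xs t) (us t) + cost_to_go pb xs us t.+1.
Proof.
move=> fin; rewrite !(cost_to_goE _ fin).
have [tT|Tt] := ltnP t T; first by rewrite big_ltn.
have [-> ->] := fin t Tt.
by rewrite stage_cost_final !big_geq ?addr0 // ltnW.
Qed.

Lemma cost_to_go_split T xs us n : stays_at_final pb T xs us ->
  cost_to_go pb xs us 0 =
    \sum_(0 <= k < n) stage_cost pb (xs k) (us k) + cost_to_go pb xs us n.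
Proof.
move=> fin; elim: n => [|n IH]; first by rewrite big_geq ?add0r.
by rewrite IH big_nat_recr //= -addrA -(cost_to_go_rec _ fin).
Qed.

Lemma cost_to_go_after_final T xs us t : stays_at_final pb T xs us ->
  (T <= t)%N -> cost_to_go pb xs us t = 0.
Proof. by move=> fin Tt; rewrite (cost_to_goE _ fin) big_geq. Qed.

Lemma min_cost_to_go_le S p : p \in S ->
  (min_cost_to_go S p.1.2 <= p.2%:E)%E.
Proof. by move=> pS; exact: (bigmin_inf_seq _ p). Qed.

(** The minimum ranges over a nonempty finite set, so the default value [+oo] is
    not the result. *)
Lemma min_cost_to_go_attained S x : x \in Pi_state S ->
  exists p, [/\ p \in S, p.1.2 = x & min_cost_to_go S x = p.2%:E].
Proof.
case/imfsetP => /= p0 p0S ->; have := min_cost_to_go_le p0S.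
rewrite {1}/min_cost_to_go.
have : min_cost_to_go S p0.1.2 = +oo%E \/
    exists p, [/\ p \in S, p.1.2 = p0.1.2 & min_cost_to_go S p0.1.2 = p.2%:E].
  rewrite /min_cost_to_go big_seq_cond.
  apply: (big_ind (fun v => v = +oo%E \/
    exists p, [/\ p \in S, p.1.2 = p0.1.2 & v = p.2%:E])).
  - by left.
  - by move=> v1 v2 H1 H2; case: (leP v1 v2).
  - by move=> p /andP[pS /eqP pE]; right; exists p.
by case=> [H|//]; rewrite -/(min_cost_to_go _ _) H.
Qed.

(** * Stored trajectories can be continued *)

Definition admissible T xs us :=
  [/\ forall t, [/\ Xset pb (xs t), Uset pb (us t)
                  & xs t.+1 = dyn pb (xs t) (us t)]
    & stays_at_final pb T xs us].

Lemma admissible_prefix T xs us :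
  (forall t, (t < T)%N ->
     [/\ Xset pb (xs t), Uset pb (us t) & xs t.+1 = dyn pb (xs t) (us t)]) ->
  stays_at_final pb T xs us -> admissible T xs us.
Proof.
move=> pre fin; split=> // t; have [/pre//|Tt] := ltnP t T.
have [-> ->] := fin t Tt; have [-> _] := fin t.+1 (leqW Tt).
by rewrite x_final_equilibrium; split=> //; [exact: x_final_Xset|exact: zero_Uset].
Qed.

Lemma cost_to_go_ge0 T xs us t : admissible T xs us ->
  0 <= cost_to_go pb xs us t.
Proof.
case=> adm fin; rewrite (cost_to_goE _ fin); apply: sumr_ge0 => k _.
by have [? ? _] := adm k; apply: stage_cost_ge0.
Qed.

(** The successor of a triple has the same trajectory index: this is what makes
    the property stable under [prune], which acts on whole trajectories. *)
Definition continuable S := forall p, p \in S ->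
  [/\ Xset pb p.1.2, 0 <= p.2
    & exists u q, [/\ Uset pb u, q \in S, q.1.1 = p.1.1,
        q.1.2 = dyn pb p.1.2 u & p.2 = stage_cost pb p.1.2 u + q.2]].

Lemma triplesP i xs us ts p :
  reflect (exists2 t, t \in ts & p = (i, xs t, cost_to_go pb xs us t))
          (p \in triples pb i xs us ts).
Proof. exact: imfsetP. Qed.

(** Times after [T] are represented by the triple stored at [T]: there the state
    is the target and the cost-to-go is 0. *)
Lemma triples_from a T i xs us t : admissible T xs us -> (a <= T)%N ->
  (a <= t)%N ->
  (i, xs t, cost_to_go pb xs us t) \in
    triples pb i xs us (iota a (T.+1 - a)).
Proof.
move=> [_ fin] aT a_t; apply/triplesP; exists (minn t T).
  by rewrite mem_iota leq_min a_t aT /= subnKC ?ltnS ?geq_minr // leqW.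
have [//|/ltnW Tt] := leqP t T.
rewrite !(cost_to_go_after_final fin) //.
by have [-> _] := fin t Tt; have [-> _] := fin T (leqnn T).
Qed.

Lemma continuable_triples a T i xs us : admissible T xs us -> (a <= T)%N ->
  continuable (triples pb i xs us (iota a (T.+1 - a))).
Proof.
move=> adm aT _ /triplesP[t + ->] /=; rewrite mem_iota => /andP[a_t _].
have [/(_ t)[Xx Uu next] fin] := adm.
split=> //; first exact: cost_to_go_ge0 adm.
exists (us t), (i, xs t.+1, cost_to_go pb xs us t.+1); split=> //.
  by apply: triples_from => //; exact: leqW.
exact: cost_to_go_rec fin.
Qed.

Lemma continuableU S1 S2 : continuable S1 -> continuable S2 ->
  continuable (S1 `|` S2)%fset.
Proof.
move=> c1 c2 p; rewrite inE => /orP[/c1|/c2] [? ? [u [q [? qS ? ? ?]]]];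
  by split=> //; exists u, q; rewrite inE qS ?orbT.
Qed.

Lemma pruneP D S p : p \in prune pb D S <->
  p \in S /\ forall q, q \in S -> q.1.1 = p.1.1 ->
    (risk pb D q.1.2 <= (delta pb)%:E)%E.
Proof.
rewrite !inE /=; split=> [/andP[pS /asboolPn nex]|[pS safe]].
  by split=> // q qS qp; rewrite leNgt; apply/negP => lt; apply: nex; exists q.
rewrite pS /=; apply/asboolPn => -[q [qS qp]].
by rewrite ltNge safe.
Qed.

Lemma prune_safe D S p : p \in prune pb D S ->
  (risk pb D p.1.2 <= (delta pb)%:E)%E.
Proof. by case/pruneP => pS; apply. Qed.

Lemma prune_id D S :
  (forall p, p \in S -> (risk pb D p.1.2 <= (delta pb)%:E)%E) ->
  prune pb D S = S.
Proof.
move=> safe; apply/fsetP => p; apply/idP/idP => [/pruneP[]//|pS].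
by apply/pruneP; split=> // q qS _; exact: safe.
Qed.

Lemma continuable_prune D S : continuable S -> continuable (prune pb D S).
Proof.
move=> cS p /pruneP[pS safe]; have [? ? [u [q [? qS qp ? ?]]]] := cS p pS.
split=> //; exists u, q; split=> //; apply/pruneP; split=> // q' q'S q'q.
by apply: safe => //; rewrite q'q.
Qed.

(** * The finite-horizon problem and the closed loop *)

(** The horizon is at least 1, so the constraints at the first step are among
    those of the problem. *)
Lemma FH_optimizer_feasible_step S D x ys vs : FH_optimizer pb S D x ys vs ->
  [/\ Xset pb x, Uset pb (vs 0%N) & (risk pb D x <= (delta pb)%:E)%E].
Proof.
by case=> -[<- /(_ 0%N (horizon_ge1 pb))[_ ? ? ?] _] _.
Qed.

Lemma DR_MPC_admissible S D T xs us : DR_MPC pb S D T xs us ->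
  admissible T xs us.
Proof.
case=> _ step fin; apply: admissible_prefix => // t /step[_ [ys [vs [opt -> ->]]]].
by have [? ? _] := FH_optimizer_feasible_step opt.
Qed.

Lemma DR_MPC_safe S D T xs us t : DR_MPC pb S D T xs us ->
  (risk pb D (x_final pb) <= (delta pb)%:E)%E ->
  (risk pb D (xs t) <= (delta pb)%:E)%E.
Proof.
case=> _ step fin safeF; have [/step[_ [ys [vs [opt _ _]]]]|Tt] := ltnP t T.
  by have [] := FH_optimizer_feasible_step opt.
by have [-> _] := fin t Tt.
Qed.

(** Drop the first step and append the step from the final state [ys K] to its
    stored successor [q]. Choosing the triple [p] at [ys K] that attains the
    minimum cost-to-go, the appended stage cost plus the cost-to-go of [q] is
    exactly the terminal cost of the original solution. *)
Lemma FH_shift S D x ys vs : continuable S ->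
  (forall p, p \in S -> (risk pb D p.1.2 <= (delta pb)%:E)%E) ->
  FH_feasible pb S D x ys vs ->
  exists zs ws, FH_feasible pb S D (dyn pb x (vs 0%N)) zs ws /\
    ((stage_cost pb x (vs 0%N))%:E + FH_cost pb S zs ws <= FH_cost pb S ys vs)%E.
Proof.
move=> cS safe [y0 step endS].
have [p [pS pE Qp]] := min_cost_to_go_attained endS.
have [Xp _ [u [q [Uu qS _ qE pJ]]]] := cS p pS.
set K := horizon pb in step endS pE Qp *.
have K0 : (0 < K)%N := horizon_ge1 pb.
exists (fun k => if (k < K)%N then ys k.+1 else q.1.2),
  (fun k => if (k.+1 < K)%N then vs k.+1 else u).
split.
  split; first by have [-> _ _ _] := step 0%N K0; rewrite K0 y0.
    move=> k kK; rewrite -/K in kK; rewrite kK; have [k1K|Kk1] := ltnP k.+1 K.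
      by have [? ? ? ?] := step _ k1K.
    have -> : k.+1 = K by apply/eqP; rewrite eqn_leq kK.
    by rewrite -pE; split=> //; exact: safe.
  by rewrite -/K ltnn; apply/imfsetP; exists q.
rewrite /FH_cost -/K ltnn Qp pJ.
apply: (@le_trans _ _ ((stage_cost pb x (vs 0%N) +
  \sum_(0 <= k < K) stage_cost pb (if (k < K)%N then ys k.+1 else q.1.2)
     (if (k.+1 < K)%N then vs k.+1 else u))%:E + q.2%:E)%E).
  by rewrite EFinD -addeA !leeD2l // min_cost_to_go_le.
rewrite -!EFinD lee_fin addrA lerD2r -{1}y0 pE.
case: (K) K0 => // n _.
rewrite big_nat_recr //= ltnSn ltnn big_nat_recl //= -addrA lerD2l lerD2r.
rewrite !big_nat; apply: ler_sum => i /andP[_ iK].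
by rewrite !ltnS iK ltnW.
Qed.

Lemma FH_cost_ge0 S D x ys vs : continuable S -> FH_feasible pb S D x ys vs ->
  (0 <= FH_cost pb S ys vs)%E.
Proof.
move=> cS [_ step /min_cost_to_go_attained[p [/cS[_ J0 _] _ Qp]]].
rewrite /FH_cost Qp -EFinD lee_fin addr_ge0 // big_nat sumr_ge0 // => k /andP[_ kK].
by have [_ ? ? _] := step k kK; exact: stage_cost_ge0.
Qed.

(** Induction on the number [T - t] of remaining steps. At the target nothing is
    left to pay, and costs are nonnegative; before it, an optimizer is the
    cheapest feasible solution and [FH_shift] leads to the next state. *)
Lemma DR_MPC_cost_le S D T xs us t ys vs : continuable S ->
  (forall p, p \in S -> (risk pb D p.1.2 <= (delta pb)%:E)%E) ->
  DR_MPC pb S D T xs us -> FH_feasible pb S D (xs t) ys vs ->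
  ((cost_to_go pb xs us t)%:E <= FH_cost pb S ys vs)%E.
Proof.
move=> cS safe [_ step fin].
have [n] := ubnP (T - t); elim: n t ys vs => // n IH t ys vs ltn feas.
have [tT|Tt] := ltnP t T; last first.
  by rewrite (cost_to_go_after_final fin Tt); exact: FH_cost_ge0 feas.
have [_ [ys' [vs' [[feas' opt] usE xsE]]]] := step t tT.
have [zs [ws [feasz costz]]] := FH_shift cS safe feas'.
apply: le_trans (opt _ _ feas); apply: le_trans costz.
rewrite (cost_to_go_rec t fin) usE EFinD leeD2l //.
apply: IH; last by rewrite xsE usE.
by rewrite ltnS in ltn; apply: leq_trans ltn; rewrite ltn_sub2l.
Qed.

(** When the horizon exceeds [T], the final state is the target, which is stored
    at time [T]. *)
Lemma FH_feasible_stored S D T i xs us :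
  admissible T xs us -> (1 <= T)%N ->
  (forall t, (risk pb D (xs t) <= (delta pb)%:E)%E) ->
  (triples pb i xs us (iota 1 T) `<=` S)%fset ->
  FH_feasible pb S D (xs 0%N) xs us /\
  (FH_cost pb S xs us <= (cost_to_go pb xs us 0)%:E)%E.
Proof.
move=> adm T1 safe /fsubsetP sub.
(* The range [iota 1 T] is the case [a = 1] of [iota a (T.+1 - a)]. *)
have endS : (i, xs (horizon pb), cost_to_go pb xs us (horizon pb)) \in S.
  by apply: sub; rewrite -[T]/(T.+1.-1) -subn1; exact: triples_from adm T1 (horizon_ge1 pb).
split.
  split=> // [k _|]; first by have [/(_ k)[]] := adm.
  by apply/imfsetP; exists (i, xs (horizon pb), cost_to_go pb xs us (horizon pb)).
have [_ fin] := adm.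
by rewrite /FH_cost (cost_to_go_split (horizon pb) fin) EFinD leeD2l // (min_cost_to_go_le endS).
Qed.

(** The initial trajectory ends at the target, which is thus one of its states. *)
Lemma initial_final_safe S D : initial_safe_set pb S ->
  (risk pb D (x_final pb) <= (delta pb)%:E)%E.
Proof.
case=> -[T [xs [us [_ _ fin SE]]]] safe; apply: risk_robustly_safe.
suff /safe[] : x_final pb \in Pi_state S by [].
apply/imfsetP; exists (0%N, xs T, cost_to_go pb xs us T); last by have [] := fin T (leqnn T).
rewrite SE; apply/triplesP; exists T => //; by rewrite mem_iota /= add0n ltnSn.
Qed.

Lemma initial_safe S D p : initial_safe_set pb S -> p \in S ->
  (risk pb D p.1.2 <= (delta pb)%:E)%E.
Proof.
case=> _ safe pS; apply: risk_robustly_safe.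
by have [] := safe p.1.2; first by apply/imfsetP; exists p.
Qed.

Lemma continuable_initial S : initial_safe_set pb S -> continuable S.
Proof.
case=> -[T [xs [us [_ step fin SE]]]] safe.
rewrite SE -[T.+1]subn0; apply: continuable_triples => //.
apply: admissible_prefix => // t tT; have [? ?] := step t tT; split=> //.
have [] // := safe (xs t).
apply/imfsetP; exists (0%N, xs t, cost_to_go pb xs us t) => //.
by rewrite SE; apply/triplesP; exists t => //; rewrite mem_iota /= add0n ltnS ltnW.
Qed.

(** * The iterative procedure *)

Section Run.
Context (w : nat -> 'rV[R]_nw) (N0 : nat) (S : nat -> safe_set R nx)
  (T : nat -> nat) (xs : nat -> nat -> state) (us : nat -> nat -> input).
Context (run : iterative_MPC pb w N0 S T xs us).

Local Notation D := (ambiguity_at pb w N0 T).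

Lemma run_continuable j : continuable (S j).
Proof.
elim: j => [|j IH]; first exact: continuable_initial (run_initial run).
rewrite (run_safe_set run (ltn0Sn j)); apply: continuable_prune.
apply: continuableU => //; rewrite -[T j.+1]/((T j.+1).+1.-1) -subn1.
apply: continuable_triples; last exact: (run_length run (ltn0Sn j)).
exact: DR_MPC_admissible (run_DR_MPC run (ltn0Sn j)).
Qed.

Lemma run_safe j p : p \in S j -> (risk pb (D j) p.1.2 <= (delta pb)%:E)%E.
Proof.
case: j => [|j]; first exact: initial_safe (run_initial run).
by rewrite (run_safe_set run (ltn0Sn j)); exact: prune_safe.
Qed.

Context (j : nat) (j_ge1 : (1 <= j)%N) (D_sub : D j `<=` D j.-1).

Lemma run_trajectory_safe t : (risk pb (D j) (xs j t) <= (delta pb)%:E)%E.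
Proof.
apply: le_trans (risk_subset _ D_sub) _.
apply: DR_MPC_safe (run_DR_MPC run j_ge1) _.
exact: initial_final_safe (run_initial run).
Qed.

Lemma run_no_deletion :
  S j = (S j.-1 `|` triples pb j (xs j) (us j) (iota 1 (T j)))%fset.
Proof.
rewrite (run_safe_set run j_ge1); apply: prune_id => p.
rewrite inE => /orP[pS|/triplesP[t _ ->]]; last exact: run_trajectory_safe.
exact: le_trans (risk_subset _ D_sub) (run_safe pS).
Qed.

Lemma run_cost_nonincreasing :
  cost_to_go pb (xs j.+1) (us j.+1) 0 <= cost_to_go pb (xs j) (us j) 0.
Proof.
have mpc := run_DR_MPC run j_ge1; have next := run_DR_MPC run (ltn0Sn j).
have [] := FH_feasible_stored (S := S j) (i := j) (DR_MPC_admissible mpc)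
  (run_length run j_ge1) run_trajectory_safe.
  by rewrite run_no_deletion fsubsetUr.
have -> : xs j 0%N = xs j.+1 0%N by have [-> _ _] := mpc; have [-> _ _] := next.
move=> feas cost; rewrite -lee_fin; apply: le_trans cost.
exact: DR_MPC_cost_le (@run_continuable j) (@run_safe j) next feas.
Qed.

End Run.
End IterativeMPC.

Theorem propositionV3 (R : realType) (nx nu nw : nat)
    (pb : problem R nx nu nw)
    (d : measure_display) (Omega : measurableType d) (P : probability Omega R)
    (law : probability (borelRV R nw) R) (law_supported : law (Wset pb) = 1%E)
    (w : nat -> Omega -> borelRV R nw) (w_iid : iid_samples P law w)
    (omega : Omega) (w_Wset : forall n, Wset pb (w n omega))
    (N0 : nat) (S : nat -> safe_set R nx) (T : nat -> nat)
    (xs : nat -> nat -> 'rV[R]_nx) (us : nat -> nat -> 'rV[R]_nu)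
    (run : iterative_MPC pb (fun n => w n omega) N0 S T xs us)
    (j : nat) (j_ge1 : (1 <= j)%N)
    (D_sub : ambiguity_at pb (fun n => w n omega) N0 T j `<=`
             ambiguity_at pb (fun n => w n omega) N0 T j.-1) :
  [/\ S j = (S j.-1 `|` triples pb j (xs j) (us j) (iota 1 (T j)))%fset,
      (S j.-1 `<=` S j)%fset
    & FH_value_continuous_at_final pb (S j)
        (ambiguity_at pb (fun n => w n omega) N0 T j) ->
      cost_to_go pb (xs j.+1) (us j.+1) 0 <= cost_to_go pb (xs j) (us j) 0].
Proof.
split; first exact: run_no_deletion run _ _ _.
  by rewrite (run_no_deletion run j_ge1 D_sub) fsubsetUl.
by move=> _; exact: run_cost_nonincreasing run _ _ _.
Qed.
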